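(* Let $K$ be a field of characteristic zero and let $A$ be a standard graded Artinian $K$-algebra. Then $A$ has the WLP (resp. SLP) if and only if there exists a linear form $z\in A_1$ such that the associated graded ring $\mathrm{Gr}_{(z)}(A)$ has the WLP (resp. SLP).
   Context: A standard graded Artinian $K$-algebra is a commutative graded algebra $A=\bigoplus_{i=0}^c A_i$ ($A_c\neq(0)$) of the form $R/I$, with $R=K[x_1,\dots,x_n]$ a polynomial ring with its standard grading, $I$ a homogeneous ideal, and $\dim_K A<\infty$. A linear form of $A$ is an element of $A_1$. $A=\bigoplus_{i=0}^c A_i$ with $A_c\ne (0)$ has the Weak Lefschetz Property (WLP) if there is $g\in A_1$ such that the multiplication $\times g: A_i\to A_{i+1}$ is injective or surjective for every $i=0,1,\dots,c-1$. $A$ has the Strong Lefschetz Property (SLP) if there is $g\in A_1$ such that $\times g^{c-2i}:A_i\to A_{c-i}$ is bijective for all $i=0,1,\dots,\lfloor c/2\rfloor$ (so the SLP forces the Hilbert function to be symmetric). For a linear form $z\in A_1$, $\mathrm{Gr}_{(z)}(A)=A/(z)\oplus (z)/(z^2)\oplus\cdots\oplus (z^{p-1})/(z^p)$, where $p$ is the least integer with $z^p=0$, with multiplication $(a+(z^{i+1}))(b+(z^{j+1}))=ab+(z^{i+j+1})$ for $a\in(z^i)$, $b\in(z^j)$. It is regarded as a standard graded Artinian $K$-algebra via the grading inherited from $A$: its degree-$d$ component is $\bigoplus_k \big((z^k)/(z^{k+1})\big)_d$, where $(z^k)/(z^{k+1})$ carries the grading induced from $A$. *)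

(* Defs.v *)
From HB Require Import structures.
From mathcomp Require Import all_boot all_algebra.
From mathcomp Require Import generic_quotient ring_quotient falgebra mpoly.

Set Implicit Arguments.
Unset Strict Implicit.
Unset Printing Implicit Defensive.

Import GRing.Theory.
Local Open Scope ring_scope.

(* A standard graded Artinian K-algebra A = A_0 + ... + A_c with A_c != 0:
   [sg_pres] says that A is R/I for R = K[x_1..x_n] and I = ker phi homogeneous,
   with A_d the image of R_d; in particular A is commutative.  Artinianness is
   the finite dimension built into [falgType]. *)
Record sgAlg (K : fieldType) := SGAlg {
  sg_alg :> falgType K;
  sg_comp : nat -> {vspace sg_alg};
  sg_pres : exists (n : nat) (phi : {lrmorphism {mpoly K[n]} -> sg_alg}),
    [/\ forall a : sg_alg, exists f : {mpoly K[n]}, phi f = a,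
        forall (f : {mpoly K[n]}) (d : nat),
          phi f = 0 -> phi (pihomog mdeg d f) = 0
      & forall (d : nat) (a : sg_alg),
          a \in sg_comp d <-> exists2 f : {mpoly K[n]}, f \is d.-homog & phi f = a];
  sg_top : nat;
  sg_top_neq0 : sg_comp sg_top != 0%VS;
  sg_top_max : forall d, (sg_top < d)%N -> sg_comp d = 0%VS
}.

Definition linform (K : fieldType) (A : sgAlg K) : predArgType :=
  subvs_of (sg_comp A 1).

Section Lefschetz.
Variables (K : fieldType) (A : sgAlg K).

Definition mul_inj (u : A) (i : nat) : Prop :=
  {in sg_comp A i &, injective ( *%R u)}.

Definition mul_surj (u : A) (i j : nat) : Prop :=
  forall b : A, b \in sg_comp A j -> exists2 a : A, a \in sg_comp A i & u * a = b.

Definition WLP : Prop :=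
  exists g : linform A, forall i : nat, (i < sg_top A)%N ->
    mul_inj (vsval g) i \/ mul_surj (vsval g) i i.+1.

Definition SLP : Prop :=
  exists g : linform A, forall i : nat, (i <= (sg_top A)./2)%N ->
    let u := vsval g ^+ (sg_top A - i.*2) in
    mul_inj u i /\ mul_surj u i (sg_top A - i).

End Lefschetz.

(* Quotient U/W, for W contained in U; [vcls a] is the coset a + W when a is in U
   and a junk value otherwise. *)
Section VQuot.
Local Open Scope quotient_scope.
Variables (K : fieldType) (V : vectType K) (U W : {vspace V}).

Definition in_sub : {pred subvs_of U} := [pred u | vsval u \in W].

Fact in_sub_zmod : zmod_closed in_sub.
Proof.
split; first by rewrite inE linear0 mem0v.
by move=> u v; rewrite !inE linearB => Wu Wv; apply: rpredB.
Qed.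
HB.instance Definition _ := GRing.isZmodClosed.Build _ in_sub in_sub_zmod.

Definition vquot : Type := Quotient.quot in_sub.
HB.instance Definition _ := GRing.Zmodule.on vquot.

Definition vcls (a : V) : vquot := \pi_(Quotient.quot in_sub) (vsproj U a).
Definition vrep (q : vquot) : V := vsval (repr (q : Quotient.quot in_sub)).

Lemma vrepP q : vrep q \in U. Proof. exact: subvsP. Qed.

Lemma vrepK q : vcls (vrep q) = q.
Proof. by rewrite /vcls vsvalK; exact: reprK. Qed.

Lemma vcls_eq a b : a \in U -> b \in U -> (vcls a = vcls b) <-> (a - b \in W).
Proof.
move=> Ua Ub; rewrite /vcls; split.
  by move/eqP; rewrite -Quotient.idealrBE inE linearB /= !vsprojK.
by move=> Wab; apply/eqP; rewrite -Quotient.idealrBE inE linearB /= !vsprojK.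
Qed.

Lemma vrep_vcls a : a \in U -> vrep (vcls a) - a \in W.
Proof. by move=> Ua; apply/vcls_eq; rewrite ?vrepP ?vrepK. Qed.

Lemma vcls_proj a : vcls (projv U a) = vcls a.
Proof.
rewrite /vcls; congr (\pi _); apply: val_inj.
by rewrite unlock /= projv_proj.
Qed.

Lemma vclsD a b : vcls (a + b) = vcls a + vcls b.
Proof. by rewrite /vcls !raddfD. Qed.

Definition vquot_scale (c : K) (q : vquot) : vquot := vcls (c *: vrep q).

Lemma vclsZ c a : vcls (c *: a) = vquot_scale c (vcls a).
Proof.
rewrite -[LHS]vcls_proj linearZ -[in RHS]vcls_proj; apply/vcls_eq.
- by rewrite memvZ ?memv_proj.
- by rewrite memvZ ?vrepP.
- by rewrite -scalerBr memvZ // -memvN opprB vrep_vcls ?memv_proj.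
Qed.

Fact vquot_scaleA c d q : vquot_scale c (vquot_scale d q) = vquot_scale (c * d) q.
Proof. by rewrite -[q]vrepK -!vclsZ scalerA. Qed.
Fact vquot_scale1 : left_id 1 vquot_scale.
Proof. by move=> q; rewrite -[q]vrepK -!vclsZ scale1r. Qed.
Fact vquot_scaleDr : right_distributive vquot_scale +%R.
Proof.
by move=> c p q; rewrite -[p]vrepK -[q]vrepK -vclsD -!vclsZ scalerDr vclsD.
Qed.
Fact vquot_scaleDl q : {morph vquot_scale^~ q : c d / c + d}.
Proof. by move=> c d /=; rewrite -[q]vrepK -!vclsZ scalerDl vclsD. Qed.
HB.instance Definition _ := GRing.Zmodule_isLmodule.Build K vquot
  vquot_scaleA vquot_scale1 vquot_scaleDr vquot_scaleDl.

Fact vcls_linear : linear vcls.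
Proof. by move=> c a b; rewrite vclsD vclsZ. Qed.
HB.instance Definition _ := GRing.isLinear.Build K V vquot _ vcls vcls_linear.

Lemma vrepD p q : vrep (p + q) - (vrep p + vrep q) \in W.
Proof. by rewrite -{1}[p]vrepK -{1}[q]vrepK -vclsD vrep_vcls ?rpredD ?vrepP. Qed.

Lemma vrepZ c q : vrep (c *: q) - c *: vrep q \in W.
Proof. by rewrite -{1}[q]vrepK -linearZ vrep_vcls ?memvZ ?vrepP. Qed.

End VQuot.

Section GradedPresentation.
Variables (K : fieldType) (G : falgType K) (C : nat -> {vspace G}).

Lemma prodv_ind (U V : {vspace G}) (P : G -> Prop) :
  P 0 -> (forall a b, P a -> P b -> P (a + b)) ->
  {in U & V, forall u v, P (u * v)} ->
  forall a, a \in (U * V)%VS -> P a.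
Proof.
move=> P0 PD PM a; rewrite unlock.
set X := allpairs _ _ _; rewrite -[X]/(tval (in_tuple X)) => /coord_span ->.
apply: (big_ind P) => // i _; set c := coord _ _ _.
have /allpairsP[[u v] /= [Uu Vv ->]] : (in_tuple X)`_i \in X by rewrite mem_nth.
by rewrite scalerAl; apply: PM; rewrite ?memvZ ?vbasis_mem.
Qed.

Hypothesis mulC : commutative (@GRing.mul G).
Hypothesis C_one : 1 \in C 0.
Hypothesis C_zero : (C 0 <= 1)%VS.
Hypothesis C_mul : forall i j, {in C i & C j, forall a b, a * b \in C (i + j)}.
Hypothesis C_gen : forall d, (C d.+1 <= C 1 * C d)%VS.
Hypothesis C_full : forall a, exists (N : nat) (b : nat -> G),
  (forall d, b d \in C d) /\ a = \sum_(d < N) b d.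
Hypothesis C_indep : forall (N : nat) (b : nat -> G),
  (forall d, b d \in C d) -> \sum_(d < N) b d = 0 -> forall d, (d < N)%N -> b d = 0.

(* A graded algebra generated in degree 1 over C_0 = K is a quotient of a
   polynomial ring by a homogeneous ideal. *)
Lemma graded_presentation :
  exists (n : nat) (phi : {lrmorphism {mpoly K[n]} -> G}),
    [/\ forall a : G, exists f : {mpoly K[n]}, phi f = a,
        forall (f : {mpoly K[n]}) (d : nat),
          phi f = 0 -> phi (pihomog mdeg d f) = 0
      & forall (d : nat) (a : G),
          a \in C d <-> exists2 f : {mpoly K[n]}, f \is d.-homog & phi f = a].
Proof.
pose n := \dim (C 1); pose h (i : 'I_n) : G := (vbasis (C 1))`_i.
pose f : {mpoly K[n]} -> G := mmap (in_alg G) h.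
have f_mul : GRing.multiplicative f.
  by apply: commr_mmap_is_multiplicative => *; apply: mulC.
have f_lin : linear f.
  by move=> c p q; rewrite /f mmapD mmapZ /= mulr_algl.
pose phi : {lrmorphism {mpoly K[n]} -> G} :=
  HB.pack f (GRing.isLinear.Build _ _ _ _ f f_lin)
    (GRing.isMultiplicative.Build _ _ f f_mul).
have phiZ c p : phi (c *: p) = c *: phi p by exact: linearZ.
have phiX m : phi 'X_[m] = mmap1 h m by rewrite /= /f mmapX.
have C_exp a i k : a \in C i -> a ^+ k \in C (i * k)%N.
  move=> Ca; elim: k => [|k IHk]; first by rewrite muln0 expr0.
  by rewrite exprS mulnS C_mul.
have C_mmap1 m : mmap1 h m \in C (mdeg m).
  rewrite mdegE /mmap1; elim/big_rec2: _ => // i d a _ Ca.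
  apply: C_mul => //; rewrite -[X in C X]mul1n; apply: C_exp.
  by rewrite vbasis_mem // mem_nth ?size_tuple.
have C_hom d p : p \is d.-homog -> phi p \in C d.
  move=> /dhomogP hp; rewrite [p]mpolyE raddf_sum big_seq memv_suml //= => m pm.
  by rewrite -[X in X \in _]/(phi _) phiZ memvZ // phiX -(hp m pm) C_mmap1.
have hom_C d a : a \in C d -> exists2 p : {mpoly K[n]}, p \is d.-homog & phi p = a.
  elim: d a => [|d IHd] a.
    move/(subvP C_zero)/vlineP=> [c ->]; exists (c *: 1).
      by rewrite rpredZ ?dhomog1.
    by rewrite linearZ rmorph1.
  move/(subvP (C_gen d)); move: a; apply: prodv_ind.
  - by exists 0; rewrite ?rpred0 ?raddf0.
  - move=> a b [p hp <-] [q hq <-]; exists (p + q); last by rewrite raddfD.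
    by rewrite rpredD.
  move=> u v Cu /IHd[q hq <-].
  exists ((\sum_(i < n) coord (vbasis (C 1)) i u *: 'X_i) * q).
    rewrite -[d.+1]add1n; apply: dhomogM => //.
    by apply: rpred_sum => i _; rewrite rpredZ ?dhomogX /= ?mdeg1.
  rewrite rmorphM; congr (_ * _); rewrite [RHS](coord_vbasis Cu) raddf_sum.
  by apply: eq_bigr => i _; rewrite -[LHS]/(phi _) phiZ phiX mmap1U.
exists n, phi; split.
- move=> a; have [N [b [Cb ->]]] := C_full a.
  have /fin_all_exists[g hg] : forall d : 'I_N, exists p, phi p = b d.
    by move=> d; have [p _ <-] := hom_C d (b d) (Cb d); exists p.
  by exists (\sum_d g d); rewrite raddf_sum; apply: eq_bigr => d _; apply: hg.
- move=> p d; set N := maxn (mmeasure mdeg p) d.+1.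
  rewrite [p in phi p](@pihomog_partitionE _ _ mdeg N) ?leq_maxl // raddf_sum => s0.
  apply: (C_indep (N := N) (b := fun e => phi (pihomog mdeg e p))) => //.
    by move=> e; apply/C_hom/pihomogP.
  exact: leq_maxr.
by move=> d a; split=> [/hom_C//|[p hp <-]]; apply: C_hom.
Qed.

End GradedPresentation.

Section GradedAlgebraFacts.
Variables (K : fieldType) (A : sgAlg K).
Implicit Types (a b : A) (i j d : nat).

Lemma sg_mulC : commutative (@GRing.mul A).
Proof.
move=> a b; have [n [phi [surj _ _]]] := sg_pres A.
by have [p <-] := surj a; have [q <-] := surj b; rewrite -!rmorphM mulrC.
Qed.

Lemma sg_one : 1 \in sg_comp A 0.
Proof.
have [n [phi [_ _ homP]]] := sg_pres A.
by apply/homP; exists 1; rewrite ?dhomog1 ?rmorph1.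
Qed.

Lemma sg_mul i j : {in sg_comp A i & sg_comp A j,
  forall a b, a * b \in sg_comp A (i + j)}.
Proof.
have [n [phi [_ _ homP]]] := sg_pres A.
move=> a b /homP[p hp <-] /homP[q hq <-]; apply/homP.
by exists (p * q); rewrite ?dhomogM ?rmorphM.
Qed.

Lemma sg_exp i k a : a \in sg_comp A i -> a ^+ k \in sg_comp A (i * k).
Proof.
move=> Aa; elim: k => [|k IHk]; first by rewrite muln0 expr0 sg_one.
by rewrite exprS mulnS sg_mul.
Qed.

Lemma sg_comp0 : (sg_comp A 0 <= 1)%VS.
Proof.
have [n [phi [_ _ homP]]] := sg_pres A.
apply/subvP=> a /homP[p /dhomogP hp <-]; rewrite [p]mpolyE raddf_sum.
rewrite big_seq memv_suml // => m /hp /eqP; rewrite mdeg_eq0 => /eqP ->.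
by rewrite -[X in X \in _]/(phi _) linearZ memvZ // mpolyX0 rmorph1 memv_line.
Qed.

Lemma sg_gen d : (sg_comp A d.+1 <= sg_comp A 1 * sg_comp A d)%VS.
Proof.
have [n [phi [_ _ homP]]] := sg_pres A.
apply/subvP=> a /homP[p /dhomogP hp <-]; rewrite [p]mpolyE raddf_sum.
rewrite big_seq memv_suml // => m /hp dm.
rewrite -[X in X \in _]/(phi _) linearZ memvZ //.
have [i mi] : exists i : 'I_n, m i != 0%N.
  apply/existsP; apply: contra_eqT dm; rewrite negb_exists => /forallP m0.
  by rewrite /= mdegE big1 // => i _; apply/eqP/negbNE/m0.
move: dm; rewrite -lep1mP in mi; rewrite -(submK mi) /= mdegD mdeg1 addn1.
case=> dm; rewrite addmC mpolyXD rmorphM memv_mul //; apply/homP.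
  by exists 'X_i; rewrite ?dhomogX /= ?mdeg1.
by exists 'X_[m - U_(i)]; rewrite ?dhomogX /= ?dm.
Qed.

Lemma sg_full a : exists b : nat -> A,
  (forall d, b d \in sg_comp A d) /\ a = \sum_(d < (sg_top A).+1) b d.
Proof.
have [n [phi [surj _ homP]]] := sg_pres A; have [p <-] := surj a.
have Ap d : phi (pihomog mdeg d p) \in sg_comp A d.
  by apply/homP; exists (pihomog mdeg d p); rewrite ?pihomogP.
exists (fun d => phi (pihomog mdeg d p)); split=> //.
set N := maxn (mmeasure mdeg p) (sg_top A).+1.
rewrite [p in LHS](@pihomog_partitionE _ _ mdeg N) ?leq_maxl // raddf_sum.
rewrite (@big_ord_widen _ _ _ (sg_top A).+1 N (fun d => phi (pihomog mdeg d p))) ?leq_maxr //.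
rewrite [RHS]big_mkcond; apply: eq_bigr => d _; rewrite ltnS; case: leqP => // top_d.
by move: (Ap d); rewrite sg_top_max // memv0 => /eqP.
Qed.

Lemma sg_indep N (b : nat -> A) : (forall d, b d \in sg_comp A d) ->
  \sum_(d < N) b d = 0 -> forall d, (d < N)%N -> b d = 0.
Proof.
have [n [phi [_ ker homP]]] := sg_pres A => Ab s0 d ltdN.
have /fin_all_exists2[f hf fE] :
    forall e : 'I_N, exists2 p : {mpoly K[n]}, p \is e.-homog & phi p = b e.
  by move=> e; apply/homP.
have := ker (\sum_e f e) d; rewrite raddf_sum (eq_bigr _ (fun e _ => fE e)).
move=> /(_ s0).
have -> : pihomog mdeg d (\sum_e f e) = \sum_e pihomog mdeg d (f e).
  exact: raddf_sum.
rewrite raddf_sum (bigD1 (Ordinal ltdN)) //=.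
rewrite big1 => [|e ne_ed]; last first.
  by rewrite (pihomog_ne0 _ (hf e)) ?raddf0 //; apply: contraNneq ne_ed => ->.
by rewrite addr0 (pihomog_dE (hf (Ordinal ltdN))) fE.
Qed.

End GradedAlgebraFacts.

Section AssociatedGraded.
Variables (K : fieldType) (A : sgAlg K) (z : linform A).
Local Notation zA := (vsval z).

(* the ideal (z^k) *)
Definition zideal (k : nat) : {vspace A} := limg (amull (zA ^+ k)).

Lemma zidealP k a : reflect (exists b, a = zA ^+ k * b) (a \in zideal k).
Proof.
apply: (iffP memv_imgP) => [[b _ ->]|[b ->]]; exists b; rewrite ?memvf ?lfunE //.
Qed.

Lemma zideal_mul i j a b :
  a \in zideal i -> b \in zideal j -> a * b \in zideal (i + j).
Proof.
move=> /zidealP[a' ->] /zidealP[b' ->]; apply/zidealP; exists (a' * b').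
by rewrite exprD -!mulrA; congr (_ * _); rewrite !mulrA; congr (_ * _); apply: sg_mulC.
Qed.

Lemma zideal_sub i j a : (i <= j)%N -> a \in zideal j -> a \in zideal i.
Proof.
move=> leij /zidealP[b ->]; apply/zidealP; exists (zA ^+ (j - i) * b).
by rewrite mulrA -exprD subnKC.
Qed.

Lemma zideal0 a : a \in zideal 0.
Proof. by apply/zidealP; exists a; rewrite expr0 mul1r. Qed.

Lemma z_exp k : zA ^+ k \in sg_comp A k.
Proof. by have := sg_exp k (subvsP z); rewrite mul1n. Qed.

Fact z_nilpotent : exists k, zA ^+ k == 0.
Proof.
by exists (sg_top A).+1; have := z_exp (sg_top A).+1; rewrite (sg_top_max (ltnSn _)) memv0.
Qed.

Definition zorder : nat := ex_minn z_nilpotent.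

Lemma z_zorder : zA ^+ zorder = 0.
Proof. by rewrite /zorder; case: ex_minnP => k /eqP. Qed.

Lemma zorder_gt0 : (0 < zorder)%N.
Proof.
rewrite lt0n; apply/eqP=> p0; have := z_zorder.
by rewrite p0 expr0 => /eqP; rewrite oner_eq0.
Qed.

Local Notation p := zorder.
Local Notation I := zideal.
Local Notation Q k := (vquot (zideal k) (zideal k.+1)).

(* A/(z) + (z)/(z^2) + ... + (z^{p-1})/(z^p), with p the least integer such that
   z^p = 0; the k-th summand is a quotient of subspaces of A. *)
Definition gr_type : Type := {dffun forall k : 'I_p, Q k}.
HB.instance Definition _ := Choice.on gr_type.

Implicit Types (x y w : gr_type).

Definition gr_of (F : forall k : 'I_p, Q k) : gr_type := finfun F.

Lemma gr_ofE F k : gr_of F k = F k. Proof. exact: ffunE. Qed.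
Lemma gr_eqP x y : (forall k, x k = y k) <-> x = y.
Proof. by split=> [/ffunP|->]. Qed.

Definition gr_zero : gr_type := gr_of (fun k => 0).
Definition gr_opp x : gr_type := gr_of (fun k => - x k).
Definition gr_add x y : gr_type := gr_of (fun k => x k + y k).
Definition gr_scale (c : K) x : gr_type := gr_of (fun k => c *: x k).

Fact gr_addA : associative gr_add.
Proof. by move=> x y w; apply/gr_eqP=> k; rewrite !gr_ofE addrA. Qed.
Fact gr_addC : commutative gr_add.
Proof. by move=> x y; apply/gr_eqP=> k; rewrite !gr_ofE addrC. Qed.
Fact gr_add0 : left_id gr_zero gr_add.
Proof. by move=> x; apply/gr_eqP=> k; rewrite !gr_ofE add0r. Qed.
Fact gr_addN : left_inverse gr_zero gr_opp gr_add.
Proof. by move=> x; apply/gr_eqP=> k; rewrite !gr_ofE addNr. Qed.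
HB.instance Definition _ :=
  GRing.isZmodule.Build gr_type gr_addA gr_addC gr_add0 gr_addN.

Lemma gr_0E k : (0 : gr_type) k = 0. Proof. exact: gr_ofE. Qed.
Lemma gr_DE x y k : (x + y) k = x k + y k. Proof. exact: gr_ofE. Qed.

Fact gr_scaleA c d x : gr_scale c (gr_scale d x) = gr_scale (c * d) x.
Proof. by apply/gr_eqP=> k; rewrite !gr_ofE scalerA. Qed.
Fact gr_scale1 : left_id 1 gr_scale.
Proof. by move=> x; apply/gr_eqP=> k; rewrite !gr_ofE scale1r. Qed.
Fact gr_scaleDr : right_distributive gr_scale +%R.
Proof. by move=> c x y; apply/gr_eqP=> k; rewrite !(gr_ofE, gr_DE) scalerDr. Qed.
Fact gr_scaleDl x : {morph gr_scale^~ x : c d / c + d}.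
Proof. by move=> c d; apply/gr_eqP=> k; rewrite !(gr_ofE, gr_DE) scalerDl. Qed.
HB.instance Definition _ := GRing.Zmodule_isLmodule.Build K gr_type
  gr_scaleA gr_scale1 gr_scaleDr gr_scaleDl.

Lemma gr_ZE c x k : (c *: x) k = c *: x k. Proof. exact: gr_ofE. Qed.

Lemma gr_sumE (T : Type) (r : seq T) (P : pred T) (F : T -> gr_type) k :
  (\sum_(t <- r | P t) F t) k = \sum_(t <- r | P t) F t k.
Proof. by elim/big_rec2: _ => [|t u v _ <-]; rewrite ?gr_0E ?gr_DE. Qed.

(* [gr_cls k a] is a + (z^{k+1}) in the summand (z^k)/(z^{k+1}), for a in (z^k) *)
Definition gr_cls (k : nat) (a : A) : gr_type :=
  gr_of (fun l => if l == k :> nat then vcls (I l) (I l.+1) a else 0).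

Fact gr_cls_linear k : linear (gr_cls k).
Proof.
move=> c a b; apply/gr_eqP=> l; rewrite gr_DE gr_ZE !gr_ofE.
by case: ifP => _; rewrite ?linearP // scaler0 addr0.
Qed.
HB.instance Definition _ k :=
  GRing.isLinear.Build K A gr_type _ (gr_cls k) (gr_cls_linear k).

Lemma gr_cls_eq (k : nat) a b : (k < p)%N -> a \in I k -> b \in I k ->
  gr_cls k a = gr_cls k b <-> a - b \in I k.+1.
Proof.
move=> ltkp Ia Ib; split=> [/gr_eqP/(_ (Ordinal ltkp))|Iab].
  by rewrite !gr_ofE eqxx => /(vcls_eq _ Ia Ib).
apply/gr_eqP=> l; rewrite !gr_ofE; case: eqP => // lk.
by apply/vcls_eq; rewrite lk.
Qed.

Lemma gr_cls_out k a : (p <= k)%N -> gr_cls k a = 0.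
Proof.
move=> lepk; apply/gr_eqP=> l; rewrite gr_ofE gr_0E ltn_eqF //.
exact: leq_trans lepk.
Qed.

Lemma gr_cls0 k a : a \in I k.+1 -> gr_cls k a = 0.
Proof.
move=> Ia; have [lepk|ltkp] := leqP p k; first exact: gr_cls_out.
rewrite -(linear0 (gr_cls k)); apply/gr_cls_eq; rewrite ?mem0v ?subr0 //.
exact: zideal_sub Ia.
Qed.

Definition gr_rep x (k : 'I_p) : A := vrep (x k).

Lemma gr_repP x k : gr_rep x k \in I k. Proof. exact: vrepP. Qed.

Lemma gr_expand x : x = \sum_(k < p) gr_cls k (gr_rep x k).
Proof.
apply/gr_eqP=> l; rewrite gr_sumE (bigD1 l) //= gr_ofE eqxx /gr_rep vrepK.
rewrite big1 ?addr0 // => k ne_kl; rewrite gr_ofE ifN //.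
by rewrite eq_sym.
Qed.

Definition gr_mul x y : gr_type := gr_of (fun k =>
  \sum_(i < p) \sum_(j < p | (i + j == k)%N)
     vcls (I k) (I k.+1) (gr_rep x i * gr_rep y j)).

Definition gr_one : gr_type := gr_cls 0 1.

Lemma gr_mulE x y : gr_mul x y =
  \sum_(i < p) \sum_(j < p) gr_cls (i + j) (gr_rep x i * gr_rep y j).
Proof.
apply/gr_eqP=> k; rewrite gr_ofE gr_sumE; apply: eq_bigr => i _.
rewrite gr_sumE big_mkcond; apply: eq_bigr => j _.
by rewrite gr_ofE eq_sym.
Qed.

Lemma gr_cls_mul_eq i j a a' b : a \in I i -> a' \in I i -> b \in I j ->
  a - a' \in I i.+1 -> gr_cls (i + j) (a * b) = gr_cls (i + j) (a' * b).
Proof.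
move=> Ia Ia' Ib Iaa'; apply/eqP; rewrite -subr_eq0 -raddfB /= -mulrBl.
by rewrite gr_cls0 // -addSn zideal_mul.
Qed.

Lemma gr_rep_cls (k l : 'I_p) a : a \in I k ->
  gr_rep (gr_cls k a) l - (if l == k then a else 0) \in I l.+1.
Proof.
move=> Ia; rewrite /gr_rep gr_ofE; case: (eqVneq l k) => [->|ne_lk].
  by rewrite eqxx vrep_vcls.
by rewrite ifN // -(linear0 (vcls (I l) (I l.+1))) vrep_vcls ?mem0v.
Qed.

Fact gr_mulC : commutative gr_mul.
Proof.
move=> x y; rewrite !gr_mulE exchange_big; apply: eq_bigr => i _.
by apply: eq_bigr => j _; rewrite addnC sg_mulC.
Qed.

Fact gr_mulDl : left_distributive gr_mul +%R.
Proof.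
move=> x y w; rewrite !gr_mulE -big_split; apply: eq_bigr => i _.
rewrite -big_split; apply: eq_bigr => j _; rewrite -[RHS]linearD -mulrDl.
apply: gr_cls_mul_eq; first exact: gr_repP.
- by rewrite rpredD ?gr_repP.
- exact: gr_repP.
by rewrite /gr_rep gr_DE vrepD.
Qed.

Lemma gr_mul0l x : gr_mul 0 x = 0.
Proof.
by apply: (@addrI _ (gr_mul 0 x)); rewrite -gr_mulDl !addr0.
Qed.

Lemma gr_mul_suml (T : Type) (r : seq T) (F : T -> gr_type) x :
  gr_mul (\sum_(t <- r) F t) x = \sum_(t <- r) gr_mul (F t) x.
Proof.
elim: r => [|t r IHr]; first by rewrite !big_nil gr_mul0l.
by rewrite !big_cons gr_mulDl IHr.
Qed.

Lemma gr_mul_sumr (T : Type) (r : seq T) (F : T -> gr_type) x :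
  gr_mul x (\sum_(t <- r) F t) = \sum_(t <- r) gr_mul x (F t).
Proof. by rewrite gr_mulC gr_mul_suml; apply: eq_bigr => t _; apply: gr_mulC. Qed.

(* (a + (z^{i+1})) (b + (z^{j+1})) = ab + (z^{i+j+1}) *)
Lemma gr_mul_cls i j a b : a \in I i -> b \in I j ->
  gr_mul (gr_cls i a) (gr_cls j b) = gr_cls (i + j) (a * b).
Proof.
move=> Ia Ib; have [lepi|ltip] := leqP p i.
  by rewrite (gr_cls_out _ lepi) gr_mul0l gr_cls_out // (leq_trans lepi) ?leq_addr.
have [lepj|ltjp] := leqP p j.
  by rewrite gr_mulC (gr_cls_out _ lepj) gr_mul0l gr_cls_out // (leq_trans lepj) ?leq_addl.
have [i' def_i] : {i' : 'I_p | i = i'} by exists (Ordinal ltip).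
have [j' def_j] : {j' : 'I_p | j = j'} by exists (Ordinal ltjp).
subst i j => {ltip ltjp}.
have eq1 (k l : 'I_p) : gr_cls (k + l)
    (gr_rep (gr_cls i' a) k * gr_rep (gr_cls j' b) l) =
    gr_cls (k + l) ((if k == i' then a else 0) * (if l == j' then b else 0)).
  have Ik : (if k == i' then a else 0) \in I k.
    by case: eqP => [->|]; rewrite ?mem0v.
  have Il : (if l == j' then b else 0) \in I l.
    by case: eqP => [->|]; rewrite ?mem0v.
  rewrite (@gr_cls_mul_eq k l _ _ _ (gr_repP _ _) Ik (gr_repP _ _)); last first.
    exact: (gr_rep_cls (k := i')).
  rewrite sg_mulC [in RHS]sg_mulC addnC; apply: gr_cls_mul_eq; rewrite ?gr_repP //.
  exact: (gr_rep_cls (k := j')).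
rewrite gr_mulE (bigD1 i') //= [X in _ + X]big1 ?addr0 => [|k ne_k]; last first.
  by rewrite big1 // => l _; rewrite eq1 (negPf ne_k) mul0r raddf0.
rewrite (bigD1 j') //= [X in _ + X]big1 ?addr0 => [|l ne_l]; last first.
  by rewrite eq1 (negPf ne_l) mulr0 raddf0.
by rewrite eq1 !eqxx.
Qed.

Fact gr_mulA : associative gr_mul.
Proof.
move=> x y w; rewrite (gr_expand x) !gr_mul_suml; apply: eq_bigr => i _.
rewrite (gr_expand y) gr_mul_suml !gr_mul_sumr gr_mul_suml.
apply: eq_bigr => j _; rewrite (gr_expand w) !gr_mul_sumr.
apply: eq_bigr => k _.
by rewrite !gr_mul_cls ?zideal_mul ?gr_repP // addnA mulrA.
Qed.

Fact gr_mul1 : left_id gr_one gr_mul.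
Proof.
move=> x; rewrite (gr_expand x) gr_mul_sumr; apply: eq_bigr => k _.
by rewrite gr_mul_cls ?zideal0 ?gr_repP // add0n mul1r.
Qed.
Fact gr_mul1r : right_id gr_one gr_mul.
Proof. by move=> x; rewrite gr_mulC gr_mul1. Qed.
Fact gr_mulDr : right_distributive gr_mul +%R.
Proof. by move=> x y w; rewrite gr_mulC gr_mulDl !(gr_mulC _ x). Qed.

Fact gr_one_neq0 : gr_one != 0.
Proof.
apply/eqP; rewrite -(linear0 (gr_cls 0)) => /gr_cls_eq.
rewrite zorder_gt0 zideal0 mem0v subr0 => /(_ isT isT isT)/zidealP[b].
move/(congr1 (fun a => zA ^+ p.-1 * a)).
rewrite mulr1 expr1 mulrA -exprSr prednK ?zorder_gt0 // z_zorder mul0r => /eqP z0.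
have: (p <= p.-1)%N by rewrite {1}/zorder; case: ex_minnP => m _; apply.
by rewrite leqNgt prednK ?zorder_gt0 ?leqnn.
Qed.

HB.instance Definition _ := GRing.Zmodule_isNzRing.Build gr_type
  gr_mulA gr_mul1 gr_mul1r gr_mulDl gr_mulDr gr_one_neq0.

Fact gr_scaleAl c x y : c *: (x * y) = (c *: x) * y.
Proof.
rewrite (gr_expand x) scaler_sumr /GRing.mul /= !gr_mul_suml scaler_sumr.
apply: eq_bigr => i _.
rewrite (gr_expand y) !gr_mul_sumr scaler_sumr; apply: eq_bigr => j _.
rewrite -!linearZ /= !gr_mul_cls ?memvZ ?gr_repP //.
by rewrite -scalerAl linearZ.
Qed.
HB.instance Definition _ := GRing.Lmodule_isLalgebra.Build K gr_type gr_scaleAl.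
Fact gr_scaleAr c x y : c *: (x * y) = x * (c *: y).
Proof. by rewrite [x * y]gr_mulC [x * _]gr_mulC; apply: scalerAl. Qed.
HB.instance Definition _ := GRing.Lalgebra_isAlgebra.Build K gr_type gr_scaleAr.

End AssociatedGraded.

Section RetractVect.
Import VectorInternalTheory.
Variables (K : fieldType) (V : lmodType K) (W : vectType K).
Variables (f : {linear V -> W}) (g : {linear W -> V}).
Hypothesis fK : cancel f g.

Let S : {vspace W} := limg (linfun (f \o g)).

Fact retract_vect_iso : Vector.axiom (dim (subvs_of S)) V.
Proof.
have Sf v : f v \in S.
  by apply/memv_imgP; exists (f v); rewrite ?memvf // lfunE /= fK.
exists (fun v => v2r (vsproj S (f v))); first by move=> c u v; rewrite !linearP.
exists (fun r => g (vsval (r2v r : subvs_of S))) => [v|r].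
  by rewrite v2rK vsprojK ?Sf.
apply: (can_inj (@r2vK _ _)); rewrite v2rK; apply: val_inj => /=.
rewrite vsprojK ?Sf //; have /memv_imgP[w _ ->] := subvsP (r2v r : subvs_of S).
by rewrite lfunE /= fK.
Qed.
End RetractVect.

Section GrStandard.
Variables (K : fieldType) (A : sgAlg K) (z : linform A).
Local Notation zA := (vsval z).
Local Notation p := (zorder z).
Local Notation I := (zideal z).
Local Notation G := (gr_type z).
Implicit Types (x y : G) (a b : A).

Definition gr_section x : {ffun 'I_p -> A} :=
  [ffun k : 'I_p => gr_rep x k - projv (I k.+1) (gr_rep x k)].
Definition gr_retract (w : {ffun 'I_p -> A}) : G :=
  gr_of (fun k => vcls (I k) (I k.+1) (w k)).

Fact gr_section_linear : linear gr_section.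
Proof.
move=> c x y; apply/ffunP=> k; rewrite !ffunE.
set W := I k.+1; have kill a : a \in W -> a - projv W a = 0.
  by move=> Wa; rewrite projv_id ?subrr.
have W0 : gr_rep (c *: x + y) k - (c *: gr_rep x k + gr_rep y k) \in W.
  rewrite /gr_rep gr_DE gr_ZE.
  rewrite -(subrK (vrep (c *: x k) + vrep (y k)) (vrep _)) -addrA rpredD ?vrepD //.
  by rewrite opprD addrACA subrr addr0 vrepZ.
have LE a : a - projv W a = (\1%VF - projv W) a.
  by rewrite add_lfunE opp_lfunE id_lfunE.
have := kill _ W0; rewrite LE linearB linearP => /eqP; rewrite subr_eq0 => /eqP.
by rewrite !LE.
Qed.
HB.instance Definition _ := GRing.isLinear.Build K G {ffun 'I_p -> A} _
  gr_section gr_section_linear.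

Fact gr_retract_linear : linear gr_retract.
Proof.
by move=> c u v; apply/gr_eqP=> k; rewrite gr_DE gr_ZE !gr_ofE !ffunE linearP.
Qed.
HB.instance Definition _ := GRing.isLinear.Build K {ffun 'I_p -> A} G _
  gr_retract gr_retract_linear.

Fact gr_sectionK : cancel gr_section gr_retract.
Proof.
move=> x; apply/gr_eqP=> k; rewrite gr_ofE ffunE linearB /=.
rewrite [vcls _ _ (projv _ _)](_ : _ = 0) ?subr0 ?vrepK //.
have W_a := memv_proj (I k.+1) (gr_rep x k).
rewrite -(linear0 (vcls (I k) (I k.+1))); apply/vcls_eq; rewrite ?mem0v ?subr0 //.
exact: zideal_sub W_a.
Qed.

HB.instance Definition _ :=
  Lmodule_hasFinDim.Build K G (retract_vect_iso gr_sectionK).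
HB.instance Definition _ := Algebra_isFalgebra.Build K G.

(* The degree-d part of (z^k)/(z^{k+1}) is the image of (z^k)_d = (z^k) :&: A_d. *)
Definition gr_comp (d : nat) : {vspace G} :=
  (\sum_(k < p) linfun (gr_cls z k) @: (I k :&: sg_comp A d))%VS.

Lemma sg_trunc M (c : nat -> A) : (forall d, c d \in sg_comp A d) ->
  (sg_top A < M)%N -> \sum_(d < M) c d = \sum_(d < (sg_top A).+1) c d.
Proof.
move=> Ac ltM; rewrite [RHS](@big_ord_widen _ _ _ (sg_top A).+1 M) //.
rewrite [RHS]big_mkcond; apply: eq_bigr => d _; rewrite ltnS; case: leqP => // top_d.
by move: (Ac d); rewrite (sg_top_max top_d) memv0 => /eqP.
Qed.

Lemma zideal_dec k a : a \in I k -> exists b : nat -> A,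
  (forall d, b d \in sg_comp A d) /\
  a = \sum_(d < (sg_top A).+1) if (k <= d)%N then zA ^+ k * b (d - k)%N else 0.
Proof.
move=> /zidealP[a' ->]; have [b [Ab ->]] := sg_full a'.
exists b; split=> //; pose c d := if (k <= d)%N then zA ^+ k * b (d - k)%N else 0.
rewrite -(@sg_trunc (k + (sg_top A).+1) c) ?leq_addl //; last first.
  move=> d; rewrite /c; case: leqP => [led|_]; last exact: mem0v.
  by have := sg_mul (z_exp z k) (Ab (d - k)%N); rewrite subnKC.
rewrite big_split_ord /= [X in _ = X + _]big1 ?add0r => [|d _]; last first.
  by rewrite /c leqNgt ltn_ord.
by rewrite mulr_sumr; apply: eq_bigr => d _; rewrite /c leq_addr addKn.
Qed.

Lemma zideal_hom k N (b : nat -> A) : (forall d, b d \in sg_comp A d) ->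
  \sum_(d < N) b d \in I k -> forall d, (d < N)%N ->
  exists2 c, c \in sg_comp A (d - k) & b d = if (k <= d)%N then zA ^+ k * c else 0.
Proof.
move=> Ab /zideal_dec[b' [Ab' sum_b]] d ltdN; exists (b' (d - k)%N) => //.
pose c e := if (k <= e)%N then zA ^+ k * b' (e - k)%N else 0.
have {}sum_b : \sum_(d < N) b d = \sum_(d < (sg_top A).+1) c d by exact: sum_b.
have Ac e : c e \in sg_comp A e.
  rewrite /c; case: leqP => [led|_]; last exact: mem0v.
  by have := sg_mul (z_exp z k) (Ab' (e - k)%N); rewrite subnKC.
pose b0 e := if (e < N)%N then b e else 0.
have Ab0 e : b0 e \in sg_comp A e by rewrite /b0; case: ifP; rewrite ?mem0v.
set M := maxn N (sg_top A).+1; have leNM : (N <= M)%N := leq_maxl _ _.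
have sum_b0 : \sum_(e < M) b0 e = \sum_(e < N) b e.
  by rewrite [RHS](@big_ord_widen _ _ _ N M) // [RHS]big_mkcond.
have Abc e : b0 e - c e \in sg_comp A e by rewrite rpredB.
have := @sg_indep _ A M _ Abc _ d (leq_trans ltdN leNM).
rewrite sumrB sum_b0 sum_b (@sg_trunc M c Ac) ?leq_maxr // subrr => /(_ erefl)/eqP.
by rewrite /b0 ltdN subr_eq0 => /eqP ->.
Qed.

Lemma zideal_comp k d a : a \in I k -> a \in sg_comp A d ->
  exists2 c, c \in sg_comp A (d - k) & a = if (k <= d)%N then zA ^+ k * c else 0.
Proof.
move=> Ia Aa; pose b e := if e == d then a else 0.
have Ab e : b e \in sg_comp A e by rewrite /b; case: eqP => [->|]; rewrite ?mem0v.
have sum_b : \sum_(e < d.+1) b e = a.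
  rewrite big_ord_recr /= big1 /b ?eqxx ?add0r // => e _.
  by rewrite ltn_eqF.
have /(@zideal_hom k d.+1 b Ab)/(_ d (ltnSn d)) : \sum_(e < d.+1) b e \in I k.
  by rewrite sum_b.
by rewrite /b eqxx.
Qed.

Lemma gr_cls_comp k d a :
  a \in I k -> a \in sg_comp A d -> gr_cls z k a \in gr_comp d.
Proof.
move=> Ia Aa; have [lepk|ltkp] := leqP p k.
  by rewrite gr_cls_out ?mem0v.
rewrite /gr_comp (bigD1 (Ordinal ltkp)) //= (subvP (addvSl _ _)) //.
by rewrite -[gr_cls z k a]lfunE memv_img // memv_cap Ia.
Qed.

Lemma gr_comp_ind d (P : G -> Prop) :
  P 0 -> (forall x y, P x -> P y -> P (x + y)) ->
  (forall k a, a \in I k -> a \in sg_comp A d -> P (gr_cls z k a)) ->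
  forall x, x \in gr_comp d -> P x.
Proof.
move=> P0 PD Pc x /memv_sumP[v Gv ->]; apply: (big_ind P) => // k _.
have /memv_imgP[a] := Gv k isT; rewrite memv_cap => /andP[Ia Aa] ->.
by rewrite lfunE; apply: Pc.
Qed.

Lemma gr_comp_coord d x (k : 'I_p) : x \in gr_comp d ->
  exists2 a, a \in (I k :&: sg_comp A d)%VS & x k = vcls (I k) (I k.+1) a.
Proof.
move: x; apply: gr_comp_ind.
- by exists 0; rewrite ?mem0v // linear0 gr_0E.
- move=> x y [a Aa xa] [b Ab yb]; exists (a + b); first exact: rpredD.
  by rewrite gr_DE xa yb linearD.
move=> l a Ia Aa; rewrite gr_ofE; case: eqP => [->|_].
  by exists a; rewrite // memv_cap Ia.
by exists 0; rewrite ?mem0v ?linear0.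
Qed.

Fact gr_C_one : 1 \in gr_comp 0.
Proof. by apply: gr_cls_comp; rewrite ?zideal0 ?sg_one. Qed.

Fact gr_C_zero : (gr_comp 0 <= 1)%VS.
Proof.
apply/subvP; apply: gr_comp_ind; first exact: mem0v.
  by move=> x y; apply: rpredD.
case=> [|k] a Ia Aa; last first.
  by have [c _ ->] := zideal_comp Ia Aa; rewrite /= linear0 mem0v.
have /vlineP[c ->] := subvP (sg_comp0 A) _ Aa.
by rewrite linearZ memvZ // memv_line.
Qed.

Fact gr_C_mul i j : {in gr_comp i & gr_comp j,
  forall x y, x * y \in gr_comp (i + j)}.
Proof.
move=> x y Gx Gy; move: x Gx; apply: gr_comp_ind => [|x1 x2 G1 G2|k a Ia Aa].
- by rewrite mul0r mem0v.
- by rewrite mulrDl rpredD.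
move: y Gy; apply: gr_comp_ind => [|y1 y2 G1 G2|l b Ib Ab].
- by rewrite mulr0 mem0v.
- by rewrite mulrDr rpredD.
by rewrite [_ * _]gr_mul_cls // gr_cls_comp ?zideal_mul ?sg_mul.
Qed.

Fact gr_C_gen d : (gr_comp d.+1 <= gr_comp 1 * gr_comp d)%VS.
Proof.
apply/subvP; apply: gr_comp_ind; first exact: mem0v.
  by move=> x y; apply: rpredD.
case=> [|k] a Ia Aa.
  move: a {Ia Aa} (subvP (sg_gen A d) _ Aa); apply: prodv_ind.
  - by rewrite linear0 mem0v.
  - by move=> a b Ga Gb; rewrite linearD rpredD.
  move=> u v Au Av; rewrite -[0%N]/(0 + 0)%N -gr_mul_cls ?zideal0 //.
  by apply: memv_mul; rewrite gr_cls_comp ?zideal0.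
have [c Ac ->] := zideal_comp Ia Aa; rewrite ltnS subSS in Ac *.
case: leqP => [lekd|_]; last by rewrite linear0 mem0v.
have Iz : zA \in I 1 by apply/zidealP; exists 1; rewrite mulr1.
have Izc : zA ^+ k * c \in I k by apply/zidealP; exists c.
rewrite exprS -mulrA -add1n -gr_mul_cls //; apply: memv_mul.
  by rewrite gr_cls_comp ?subvsP.
rewrite gr_cls_comp //.
by have := sg_mul (z_exp z k) Ac; rewrite subnKC.
Qed.

Fact gr_C_full x : exists (N : nat) (b : nat -> G),
  (forall d, b d \in gr_comp d) /\ x = \sum_(d < N) b d.
Proof.
have /fin_all_exists[b xb] : forall k : 'I_p, exists b : nat -> A,
    (forall d, b d \in (I k :&: sg_comp A d)%VS) /\
    gr_rep x k = \sum_(d < (sg_top A).+1) b d.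
  move=> k; have [b [Ab ->]] := zideal_dec (gr_repP x k).
  exists (fun d => if (k <= d)%N then zA ^+ k * b (d - k)%N else 0); split=> // d.
  case: leqP => [led|_]; last exact: mem0v.
  rewrite memv_cap; apply/andP; split; first by apply/zidealP; exists (b (d - k)%N).
  by have := sg_mul (z_exp z k) (Ab (d - k)%N); rewrite subnKC.
exists (sg_top A).+1, (fun d => \sum_(k < p) gr_cls z k (b k d)); split=> [d|].
  apply: rpred_sum => k _; have := (xb k).1 d; rewrite memv_cap => /andP[Ib Ab].
  exact: gr_cls_comp.
rewrite [x in LHS]gr_expand exchange_big /=; apply: eq_bigr => k _.
by rewrite (xb k).2 linear_sum.
Qed.

Fact gr_C_indep N (b : nat -> G) : (forall d, b d \in gr_comp d) ->
  \sum_(d < N) b d = 0 -> forall d, (d < N)%N -> b d = 0.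
Proof.
move=> Gb s0 d ltdN; apply/gr_eqP=> k; rewrite gr_0E.
have H e : exists a,
    (a \in (I k :&: sg_comp A e)%VS) && (b e k == vcls (I k) (I k.+1) a).
  by have [a Aa ba] := gr_comp_coord k (Gb e); exists a; rewrite Aa ba eqxx.
pose a e := xchoose (H e).
have Aa e : a e \in sg_comp A e.
  by have := xchooseP (H e); rewrite memv_cap => /andP[/andP[]].
have Ia e : a e \in I k.
  by have := xchooseP (H e); rewrite memv_cap => /andP[/andP[]].
have ba e : b e k = vcls (I k) (I k.+1) (a e).
  by have := xchooseP (H e) => /andP[_ /eqP].
have sum_a : \sum_(e < N) a e \in I k.+1.
  have /gr_eqP/(_ k) := s0; rewrite gr_sumE gr_0E (eq_bigr _ (fun (e : 'I_N) _ => ba e)).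
  rewrite -linear_sum -(linear0 (vcls (I k) (I k.+1))) => /vcls_eq.
  by rewrite subr0; apply; rewrite ?mem0v ?rpred_sum.
have [c _ ac] := zideal_hom Aa sum_a ltdN.
rewrite ba -(linear0 (vcls (I k) (I k.+1))); apply/vcls_eq; rewrite ?mem0v ?subr0 //.
by rewrite ac; case: ifP => _; rewrite ?mem0v //; apply/zidealP; exists c.
Qed.

Fact gr_top_neq0 : gr_comp (sg_top A) != 0%VS.
Proof.
have := sg_top_neq0 A; rewrite -vpick0; set a := vpick _ => a_neq0.
have Aa : a \in sg_comp A (sg_top A) by apply: memv_pick.
have ex_k : exists k, a \in I k by exists 0%N; apply: zideal0.
have le_k k : a \in I k -> (k <= p)%N.
  move=> Ia; rewrite leqNgt; apply: contra a_neq0 => ltpk.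
  have /zidealP[b ->] := zideal_sub (ltnW ltpk) Ia.
  by rewrite z_zorder mul0r.
have [k Ia max_k] := ex_maxnP ex_k le_k.
have ltkp : (k < p)%N.
  rewrite ltn_neqAle le_k // andbT; apply: contraNneq a_neq0 => k_p.
  by move: Ia => /zidealP[b ->]; rewrite k_p z_zorder mul0r.
apply: contraTneq (gr_cls_comp Ia Aa) => ->; rewrite memv0; apply/eqP.
rewrite -(linear0 (gr_cls z k)) => /(gr_cls_eq ltkp Ia (mem0v _)).
by rewrite subr0 => /max_k; rewrite ltnn.
Qed.

Fact gr_top_max d : (sg_top A < d)%N -> gr_comp d = 0%VS.
Proof.
move=> top_d; apply/eqP; rewrite -subv0; apply/subvP; apply: gr_comp_ind.
- exact: mem0v.
- by move=> x y; apply: rpredD.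
by move=> k a _; rewrite (sg_top_max top_d) !memv0 => /eqP ->; rewrite linear0.
Qed.

Definition Gr : sgAlg K :=
  SGAlg (graded_presentation (gr_mulC (z := z)) gr_C_one gr_C_zero gr_C_mul
    gr_C_gen gr_C_full gr_C_indep) gr_top_neq0 gr_top_max.

End GrStandard.

(* Main.v *)
Require Import Defs.
From mathcomp Require Import all_boot all_algebra.
From mathcomp Require Import falgebra.

(** The algebra [Gr z] is a degeneration of [A], and injectivity or surjectivity
    of a linear map is an open condition, so a Lefschetz element of [Gr z]
    deforms to one of [A].  The converse is trivial: for [z = 0] the associated
    graded algebra is [A] itself ([WLP_gr0], [SLP_gr0]).

    In detail, a linear form of [Gr z] is [h = [g] + [w]*], with [g] in [A_1]
    read modulo [(z)] and [w] a multiple of [z] read in [(z)/(z^2)]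
    ([gr_linear_form]).  In the Rees algebra of the [(z)]-adic filtration [h]
    is the value at [s = 0] of a family whose value at [s != 0] is
    [g + s^-1 w], or, up to the invertible scalar [s], the form [s g + w] of [A].
    To compare the two multiplications without forming the Rees algebra, each
    filtration [F_k = (z^k) :&: A_i] is split by linear maps [zpart i k], which
    gives for every [s != 0] an injective linear map [symbol i s] from [A_i] to
    the degree-[i] part of [Gr z], scaling the [k]-th part by [s ^+ k].
    Transporting the multiplication by [(s g + w) ^+ d] through these maps
    yields [rees i], a family polynomial in [s] once the factor [s ^+ (d + p)]
    is divided out, with [p] the order of nilpotency of [z] ([rees_pencil]):
    multiplication by [w] raises the filtration index, so no negative power of
    [s] remains.  At [s = 0] only the leading parts survive, and these are the
    products in [Gr z] ([rees0]).

    A polynomial family of linear maps which is injective (or onto) at [s = 0]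
    is so outside the zeros of some nonzero polynomial ([generic_inj],
    [generic_surj]): composing with a one-sided inverse at [s = 0] gives
    endomorphisms whose determinant is a polynomial in [s] with value [1] at [0].
    The Lefschetz properties are finitely many conditions of this sort, and a
    field of characteristic zero is infinite, so one [s] serves them all. *)

Set Implicit Arguments.
Unset Strict Implicit.
Unset Printing Implicit Defensive.

Import GRing.Theory passmx.
Local Open Scope ring_scope.

(** * Generic scalars and polynomial families of linear maps *)

Section Generic.
Variable K : fieldType.
Implicit Types (P Q : K -> Prop) (V W : vectType K).

(** Genericity is witnessed by a single polynomial rather than by a finite set of
    exceptions, because determinants produce such polynomials and products of
    them give conjunctions. *)
Definition generic P : Prop :=
  exists2 q : {poly K}, q != 0 & forall s, q.[s] != 0 -> P s.

Lemma generic_mono P Q : (forall s, P s -> Q s) -> generic P -> generic Q.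
Proof. by move=> PQ [q q0 qP]; exists q => // s /qP/PQ. Qed.

Lemma generic_true P : (forall s, P s) -> generic P.
Proof. by move=> allP; exists 1; rewrite ?oner_neq0. Qed.

Lemma generic_and P Q : generic P -> generic Q -> generic (fun s => P s /\ Q s).
Proof.
move=> [p p0 pP] [q q0 qQ]; exists (p * q); first by rewrite mulf_neq0.
by move=> s; rewrite hornerM mulf_eq0 negb_or => /andP[/pP ? /qQ].
Qed.

Lemma generic_neq0 : generic (fun s => s != 0).
Proof. by exists 'X; rewrite ?polyX_eq0 // => s; rewrite hornerX. Qed.

Lemma generic_forall n (P : nat -> K -> Prop) :
  (forall i, (i < n)%N -> generic (P i)) ->
  generic (fun s => forall i, (i < n)%N -> P i s).
Proof.
elim: n => [|n IHn] genP; first exact: generic_true.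
have := generic_and (IHn (fun i lt_in => genP i (ltnW lt_in))) (genP n (ltnSn n)).
apply: generic_mono => s [Plt Pn] i; rewrite ltnS leq_eqVlt.
by case/predU1P=> [->|/Plt].
Qed.

(** Characteristic zero makes [K] infinite: the images in [K] of the first [n]
    natural numbers are pairwise distinct, too many to be all roots of a nonzero
    polynomial of size [n]. *)
Lemma generic_witness P : [pchar K] =i pred0 -> generic P -> exists s, P s.
Proof.
move=> /pcharf0P charK [q q0 qP].
pose rs : seq K := [seq n%:R | n <- iota 0 (size q)].
have rs_uniq : uniq rs.
  rewrite map_inj_uniq ?iota_uniq // => m n.
  wlog le_mn : m n / (m <= n)%N.
    by move=> wlog_mn; case/orP: (leq_total m n) => le_mn mn; [|apply: esym];
      apply: wlog_mn.
  move/eqP; rewrite eq_sym -subr_eq0 -natrB // charK subn_eq0 => le_nm.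
  by apply/eqP; rewrite eqn_leq le_mn.
have /allPn[s _ qs] : ~~ all (root q) rs.
  apply/negP => /max_poly_roots/(_ rs_uniq); rewrite size_map size_iota ltnn.
  by move/(_ q0).
by exists s; apply: qP.
Qed.

Definition pencil V W N (h : nat -> 'Hom(V, W)) (s : K) : 'Hom(V, W) :=
  \sum_(e < N) s ^+ e *: h e.

Lemma pencilE V W N (h : nat -> 'Hom(V, W)) s v :
  pencil N h s v = \sum_(e < N) s ^+ e *: h e v.
Proof. by rewrite sum_lfunE; apply: eq_bigr => e _; rewrite scale_lfunE. Qed.

(** The determinant of the pencil is a polynomial in [s] whose value at [0] is
    the determinant of the identity. *)
Lemma generic_bij V N (h : nat -> 'End(V)) : (0 < N)%N -> h 0 = \1%VF ->
  generic (fun s => lker (pencil N h s) == 0%VS).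
Proof.
case: N => // N _ h0; pose B := vbasis {:V}.
have freeB : free B by apply: basis_free (vbasisP _).
pose M : 'M[{poly K}]_(\dim {:V}) :=
  \sum_(e < N.+1) 'X^e *: map_mx polyC (mxof B B (h e)).
have ME s : map_mx (horner_eval s) M = mxof B B (pencil N.+1 h s).
  rewrite /M /pencil !raddf_sum; apply: eq_bigr => e _.
  apply/matrixP=> i j; rewrite !mxE /=.
  rewrite /horner_eval hornerM hornerXn hornerC.
  by rewrite scale_lfunE linearZ.
have detE s : (\det M).[s] = \det (mxof B B (pencil N.+1 h s)).
  by rewrite -ME det_map_mx.
exists (\det M).
  apply: contra_neq (oner_neq0 K) => M0.
  have := detE 0; rewrite M0 horner0 /pencil big_ord_recl big1 => [|e _]; last first.
    by rewrite expr0n scale0r.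
  by rewrite expr0 scale1r addr0 h0 mxof1 // det1.
move=> s; rewrite detE => detM; rewrite (lker_ker (vbasisP {:V})).
have /eqP -> : kermx (mxof B B (pencil N.+1 h s)) == 0.
  by rewrite kermx_eq0 row_free_unit unitmxE unitfE.
by rewrite vsof0 ?vbasisP.
Qed.

(** With [B] a left inverse of [h 0] on [U], the maps [B \o h e], extended by the
    identity on a complement of [U], form a pencil that is the identity at [0];
    where that pencil is invertible, [h] is injective on [U]. *)
Lemma generic_inj V W N (U : {vspace V}) (h : nat -> 'Hom(V, W)) :
  (0 < N)%N -> (U :&: lker (h 0%N) = 0)%VS ->
  generic (fun s => U :&: lker (pencil N h s) = 0)%VS.
Proof.
move=> N_gt0 h0_inj; pose f := (h 0%N \o projv U)%VF; pose B := (projv U \o f^-1)%VF.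
have BK u : u \in U -> B (h 0%N u) = u.
  move=> Uu; have fu : f u = h 0%N u by rewrite comp_lfunE projv_id.
  apply/eqP; rewrite -subr_eq0 -memv0 -h0_inj memv_cap memv_ker linearB /=.
  rewrite rpredB //= ?comp_lfunE ?memv_proj // subr_eq0 -fu.
  have := limg_lfunVK (memv_img f (memvf u)); rewrite comp_lfunE => ->.
  exact: eqxx.
(* the extension by the identity off the subspace enters the constant term only *)
pose T e := (B \o h e \o projv U + (e == 0%N)%:R *: (\1 - projv U))%VF.
have T0 : T 0%N = \1%VF.
  apply/lfunP=> v; rewrite /T eqxx scale1r !add_lfunE opp_lfunE id_lfunE.
  by rewrite !comp_lfunE -[in X in X + _]comp_lfunE BK ?memv_proj // addrC subrK.
apply: generic_mono (generic_bij N_gt0 T0) => s /lker0P T_inj.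
apply/eqP; rewrite -subv0; apply/subvP=> u; rewrite memv_cap memv_ker memv0.
case/andP=> Uu /eqP hu; apply/eqP/T_inj; rewrite linear0 pencilE.
transitivity (B (pencil N h s u)); last by rewrite hu linear0.
rewrite pencilE linear_sum; apply: eq_bigr => e _.
rewrite linearZ /T add_lfunE scale_lfunE add_lfunE opp_lfunE id_lfunE.
by rewrite 2!comp_lfunE projv_id // subrr scaler0 addr0.
Qed.

(** Dual to [generic_inj], with a right inverse [B] of [h 0] on [Y].  All the
    [h e] have to map [U] into [Y]: this is what forces a preimage under the
    extended pencil of a vector of [Y] to lie in [Y] itself. *)
Lemma generic_surj V W N (U : {vspace V}) (Y : {vspace W}) (h : nat -> 'Hom(V, W)) :
  (0 < N)%N -> (forall e, h e @: U <= Y)%VS -> (Y <= h 0%N @: U)%VS ->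
  generic (fun s => Y <= pencil N h s @: U)%VS.
Proof.
case: N => // N _ hUY h0_surj.
pose f := (h 0%N \o projv U)%VF; pose B := (projv U \o f^-1)%VF.
have BK y : y \in Y -> h 0%N (B y) = y.
  move=> /(subvP h0_surj) hy; rewrite /B comp_lfunE -[LHS]comp_lfunE.
  by apply: limg_lfunVK; rewrite limg_comp limg_proj.
have BU y : B y \in U by rewrite comp_lfunE memv_proj.
pose T e := (h e \o B \o projv Y + (e == 0%N)%:R *: (\1 - projv Y))%VF.
have T0 : T 0%N = \1%VF.
  apply/lfunP=> v; rewrite /T eqxx scale1r !add_lfunE opp_lfunE id_lfunE.
  by rewrite 2!comp_lfunE BK ?memv_proj // addrC subrK.
apply: generic_mono (generic_bij (ltn0Sn N) T0) => s T_inj; apply/subvP=> y Yy.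
have TE w : pencil N.+1 T s w = pencil N.+1 h s (B (projv Y w)) + (w - projv Y w).
  rewrite !pencilE [in RHS]big_ord_recl big_ord_recl -addrA [X in _ = _ + X]addrC addrA.
  congr (_ + _).
    rewrite !expr0 !scale1r T0 id_lfunE BK ?memv_proj //.
    by rewrite addrC subrK.
  apply: eq_bigr => e _; rewrite /T scale0r addr0.
  by rewrite !comp_lfunE.
have /memv_imgP[w _ yE] : y \in limg (pencil N.+1 T s) by rewrite lker0_limgf ?memvf.
have hY u : u \in U -> pencil N.+1 h s u \in Y.
  move=> Uu; rewrite pencilE rpred_sum // => e _; rewrite rpredZ //.
  by rewrite (subvP (hUY e)) ?memv_img.
have Yw : w \in Y.
  have : w - projv Y w \in Y.
    by have := rpredB Yy (hY _ (BU (projv Y w))); rewrite yE TE [X in X - _]addrC addrK.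
  by move/(fun H => rpredD H (memv_proj Y w)); rewrite subrK.
by rewrite yE TE !projv_id // subrr addr0 memv_img.
Qed.
End Generic.

(** * Splitting the (z)-adic filtration in each degree *)

Section Symbols.
Variables (K : fieldType) (A : sgAlg K) (z : linform A).
Local Notation p := (zorder z).
Local Notation I := (zideal z).
Local Notation G := (gr_type z).
Implicit Types (a b y : A) (i k l : nat) (s : K).

Definition zcomp i k : {vspace A} := (I k :&: sg_comp A i)%VS.

Lemma zcompP i k a : reflect (a \in I k /\ a \in sg_comp A i) (a \in zcomp i k).
Proof. by rewrite memv_cap; apply: andP. Qed.

Lemma zcomp_sub i k l : (k <= l)%N -> (zcomp i l <= zcomp i k)%VS.
Proof.
move=> le_kl; apply/subvP=> a /zcompP[Ia Aa]; apply/zcompP; split=> //.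
exact: zideal_sub Ia.
Qed.

Lemma zcomp0 i a : (a \in zcomp i 0) = (a \in sg_comp A i).
Proof. by rewrite memv_cap zideal0. Qed.

Lemma zcomp_out i k : (p <= k)%N -> zcomp i k = 0%VS.
Proof.
move=> le_pk; apply/eqP; rewrite -subv0; apply/subvP=> a /zcompP[Ia _].
by have /zidealP[b ->] := zideal_sub le_pk Ia; rewrite z_zorder mul0r mem0v.
Qed.

Lemma zcomp_mul i j k l a b :
  a \in zcomp i k -> b \in zcomp j l -> a * b \in zcomp (i + j) (k + l).
Proof.
move=> /zcompP[Ia Aa] /zcompP[Ib Ab]; apply/zcompP.
by split; [apply: zideal_mul | apply: sg_mul].
Qed.

(** The difference of two successive projections, chosen independently: it need
    not be idempotent.  It is enough that [zpart i k] takes values in [F_k],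
    kills [F_(k+1)] and is congruent to the identity modulo [F_(k+1)] on [F_k]. *)
Definition zpart i k : 'End(A) := projv (zcomp i k) - projv (zcomp i k.+1).

Lemma zpartE i k a : zpart i k a = projv (zcomp i k) a - projv (zcomp i k.+1) a.
Proof. by rewrite add_lfunE opp_lfunE. Qed.

Lemma mem_zpart i k a : zpart i k a \in zcomp i k.
Proof.
by rewrite zpartE rpredB ?memv_proj ?(subvP (zcomp_sub i (leqnSn k))) ?memv_proj.
Qed.

Lemma zpart_lt i k l a : a \in zcomp i k -> (l < k)%N -> zpart i l a = 0.
Proof.
move=> Fa lt_lk; have Fl := subvP (zcomp_sub i lt_lk) _ Fa.
by rewrite zpartE !projv_id ?subrr // (subvP (zcomp_sub i (leqnSn l))).
Qed.

Lemma gr_cls_zpart i k a : a \in zcomp i k ->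
  gr_cls z k (zpart i k a) = gr_cls z k a.
Proof.
move=> Fa; rewrite zpartE projv_id // linearB /= [X in _ - X]gr_cls0 ?subr0 //.
by have /zcompP[] := memv_proj (zcomp i k.+1) a.
Qed.

(** For [s = 1], sends an element of degree [i] to the sum of the classes of its
    parts; another [s] composes this with the automorphism of [Gr z] that
    multiplies the summand (z^k)/(z^{k+1}) by [s ^+ k]. *)
Definition symbol i s : 'Hom(A, G) :=
  pencil p (fun k => linfun (gr_cls z k) \o zpart i k)%VF s.

Lemma symbolE i s a :
  symbol i s a = \sum_(k < p) s ^+ k *: gr_cls z k (zpart i k a).
Proof. by rewrite pencilE; apply: eq_bigr => k _; rewrite comp_lfunE lfunE. Qed.

(** If the symbol vanishes, an element of [F_k] has zero class in
    [F_k/F_(k+1)], hence lies in [F_(k+1)]; climbing the filtration it ends up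
    in [F_p = 0]. *)
Lemma symbol_inj i s a : s != 0 -> a \in sg_comp A i -> symbol i s a = 0 -> a = 0.
Proof.
move=> s_neq0 Aa Sa0; suff Fa k : a \in zcomp i k.
  by apply/eqP; rewrite -memv0 -(zcomp_out i (leqnn p)).
elim: k => [|k Fa]; first by rewrite zcomp0.
have [le_pk|lt_kp] := leqP p k; first by move: Fa; rewrite !zcomp_out // ltnW.
have /zcompP[Ia _] := Fa; have /zcompP[Ik _] := mem_zpart i k a.
have : gr_cls z k a = gr_cls z k 0.
  rewrite linear0 -(gr_cls_zpart Fa); apply/gr_eqP => l; rewrite gr_0E.
  have /gr_eqP/(_ (Ordinal lt_kp)) := Sa0.
  rewrite symbolE gr_sumE gr_0E (bigD1 (Ordinal lt_kp)) //= big1 => [|l' ne_l'].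
    rewrite addr0 gr_ZE => /eqP; rewrite scaler_eq0 expf_eq0 (negPf s_neq0) andbF.
    rewrite gr_ofE eqxx => /eqP cls0; rewrite gr_ofE; case: eqP => // lk.
    have -> : l = Ordinal lt_kp by apply: val_inj.
    exact: cls0.
  rewrite gr_ZE gr_ofE ifN ?scaler0 //.
  by rewrite eq_sym.
move/(gr_cls_eq lt_kp Ia (mem0v _)); rewrite subr0 => Ia1.
by apply/zcompP.
Qed.

Lemma symbol_mem i s a : symbol i s a \in gr_comp z i.
Proof.
rewrite symbolE rpred_sum // => k _; rewrite rpredZ //.
by have /zcompP[] := mem_zpart i k a; apply: gr_cls_comp.
Qed.

(** On [F_k] the first [k] parts vanish.  The factor [s ^+ k] gained here is
    what compensates the powers of [s] in [multiplier] and [dilation]. *)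
Lemma symbol_shift i s k y : y \in zcomp i k ->
  symbol i s y = s ^+ k *: \sum_(e < p) s ^+ e *: gr_cls z (k + e) (zpart i (k + e) y).
Proof.
move=> Fy; pose t l := s ^+ l *: gr_cls z l (zpart i l y).
have -> : symbol i s y = \sum_(l < k + p) t l.
  rewrite symbolE [LHS](@big_ord_widen _ _ _ p (k + p) t) ?leq_addl //.
  rewrite big_mkcond; apply: eq_bigr => l _; case: ltnP => // le_pl.
  by rewrite /t gr_cls_out ?scaler0.
rewrite big_split_ord /= big1 => [|l _]; last first.
  by rewrite /t (zpart_lt Fy) ?linear0 ?scaler0.
rewrite add0r scaler_sumr; apply: eq_bigr => e _.
by rewrite /t exprD scalerA.
Qed.

(** By descending induction on [k]: the class of [a] in (z^k)/(z^{k+1}) is the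
    symbol of [a] up to classes in the later summands. *)
Lemma symbol_surj i : (gr_comp z i <= symbol i 1 @: sg_comp A i)%VS.
Proof.
suff im n k a : (p <= k + n)%N -> a \in zcomp i k ->
    gr_cls z k a \in (symbol i 1 @: sg_comp A i)%VS.
  apply/subvP; apply: gr_comp_ind; first exact: mem0v.
    by move=> x y; apply: rpredD.
  by move=> k a Ia Aa; apply: (im p); [apply: leq_addl | apply/zcompP].
elim: n k a => [|n IHn] k a; first by rewrite addn0 => /gr_cls_out-> _; apply: mem0v.
rewrite addnS => le_p Fa; have [le_pk|lt_kp] := leqP p k.
  by rewrite gr_cls_out ?mem0v.
have /zcompP[_ Aa] := Fa.
have : symbol i 1 a \in (symbol i 1 @: sg_comp A i)%VS by apply: memv_img.
rewrite (symbol_shift _ Fa) expr1n scale1r (bigD1 (Ordinal (zorder_gt0 z))) //=.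
rewrite addn0 expr0 scale1r gr_cls_zpart // rpredDr // rpred_sum // => e e_neq0.
rewrite rpredZ // IHn ?mem_zpart // (leq_trans le_p) // -addSn leq_add2r.
by rewrite -[X in (X < _)%N]addn0 ltn_add2l lt0n.
Qed.

(** * The Rees deformation of a multiplication *)

Section Multiplier.
Variables (d : nat) (m : nat -> A).
Hypothesis Fm : forall r, m r \in zcomp d r.

(** The element of [Gr z] with leading parts [m r], and the family of elements of
    [A] that degenerates to it.  Rescaling the index [r] by [s ^+ r], as in
    [symbol], should turn the family into the constant one; the exponent is
    [d - r] instead of [- r] to stay polynomial in [s]. *)
Definition gr_multiplier : G := \sum_(r < d.+1) gr_cls z r (m r).
Definition multiplier s : A := \sum_(r < d.+1) s ^+ (d - r) *: m r.

(** The analogue on the source of the scaling in [symbol]; it should multiply the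
    [w]-th part by [s ^- w], and the factor [s ^+ p] keeps it polynomial. *)
Definition dilation i s : 'End(A) := \sum_(w < p) s ^+ (p - w) *: zpart i w.

Lemma dilationE i s a : dilation i s a = \sum_(w < p) s ^+ (p - w) *: zpart i w a.
Proof. by rewrite sum_lfunE; apply: eq_bigr => w _; rewrite scale_lfunE. Qed.

(** The coefficient of [s ^+ e] in the multiplication by the family [m], read in
    [Gr z]: the part of filtration index [e] above the expected index [r + w] of
    the product of [m r] with a [w]-th part. *)
Definition rees i e : 'Hom(A, G) := \sum_(w < p) \sum_(r < d.+1)
  (linfun (gr_cls z (r + w + e)) \o zpart (d + i) (r + w + e) \o amull (m r)
   \o zpart i w)%VF.

Lemma reesE i e a : rees i e a = \sum_(w < p) \sum_(r < d.+1)
  gr_cls z (r + w + e) (zpart (d + i) (r + w + e) (m r * zpart i w a)).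
Proof.
rewrite sum_lfunE; apply: eq_bigr => w _; rewrite sum_lfunE; apply: eq_bigr => r _.
by rewrite !comp_lfunE !lfunE.
Qed.

Lemma rees_mem i e a : rees i e a \in gr_comp z (d + i).
Proof.
rewrite reesE; apply: rpred_sum => w _; apply: rpred_sum => r _.
have /zcompP[] := mem_zpart (d + i) (r + w + e) (m r * zpart i w a).
exact: gr_cls_comp.
Qed.

(** A product of [m r] with a [w]-th part comes with [s ^+ (d - r)] from
    [multiplier], [s ^+ (p - w)] from [dilation] and [s ^+ (r + w)] from
    [symbol_shift], in all [s ^+ (d + p)] whatever [r] and [w]. *)
Lemma rees_pencil i s a :
  s ^+ (d + p) *: pencil p (rees i) s a =
  symbol (d + i) s (multiplier s * dilation i s a).
Proof.
rewrite dilationE mulr_sumr linear_sum pencilE.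
under eq_bigr do rewrite reesE scaler_sumr.
rewrite exchange_big scaler_sumr; apply: eq_bigr => w _ /=.
under eq_bigr do rewrite scaler_sumr.
rewrite exchange_big scaler_sumr mulr_suml linear_sum; apply: eq_bigr => r _ /=.
rewrite -scalerAl -scalerAr !linearZ /=.
rewrite (symbol_shift _ (zcomp_mul (Fm r) (mem_zpart i w a))).
rewrite !scalerA -!exprD; congr (s ^+ _ *: _).
have le_rd : (r <= d)%N by rewrite -ltnS.
rewrite [(r + w)%N]addnC -addnA [(_ + (w + r))%N]addnA.
by rewrite (subnK (ltnW (ltn_ord w))) addnCA (subnK le_rd) addnC.
Qed.

(** The part of index exactly [r + w] of a product in [F_(r+w)] has the same class
    as the product, and multiplication in [Gr z] is multiplication of such
    classes. *)
Lemma rees0 i a : rees i 0 a = gr_multiplier * symbol i 1 a.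
Proof.
rewrite reesE symbolE mulr_sumr; apply: eq_bigr => w _.
rewrite mulr_suml; apply: eq_bigr => r _; rewrite expr1n scale1r addn0.
rewrite gr_cls_zpart ?zcomp_mul ?mem_zpart // [RHS]gr_mul_cls //.
  by have /zcompP[] := Fm r.
by have /zcompP[] := mem_zpart i w a.
Qed.

Lemma dilation_mem i s a : dilation i s a \in sg_comp A i.
Proof.
rewrite dilationE rpred_sum // => w _; rewrite rpredZ //.
by have /zcompP[] := mem_zpart i w a.
Qed.

(** Injectivity of the pencil at [s] first makes [dilation i s] injective on
    [A_i], hence onto [A_i] by finite dimension; then the multiplication is
    injective on all of [A_i] and not only on the image of the dilation. *)
Lemma multiplier_inj i :
  @mul_inj K (Gr z) gr_multiplier i -> generic (fun s => mul_inj (multiplier s) i).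
Proof.
move=> H_inj; have rees_inj : (sg_comp A i :&: lker (rees i 0) = 0)%VS.
  apply/eqP; rewrite -subv0; apply/subvP=> a; rewrite memv_cap memv_ker memv0.
  case/andP=> Aa /eqP; rewrite rees0 => Ha0; apply/eqP.
  apply: (symbol_inj (oner_neq0 K) Aa); apply: H_inj; rewrite ?mem0v ?symbol_mem //.
  by rewrite mulr0.
have := generic_and (generic_neq0 K) (generic_inj (zorder_gt0 z) rees_inj).
apply: generic_mono => s [s_neq0 s_inj].
have ker0 a : a \in sg_comp A i -> multiplier s * dilation i s a = 0 -> a = 0.
  move=> Aa ua0; apply/eqP; rewrite -memv0 -s_inj memv_cap Aa memv_ker.
  have /eqP := rees_pencil i s a; rewrite ua0 linear0 scaler_eq0.
  by rewrite expf_eq0 (negPf s_neq0) andbF.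
have dil_onto : (dilation i s @: sg_comp A i)%VS = sg_comp A i.
  apply/eqP; rewrite eqEdim; apply/andP; split.
    by apply/subvP=> _ /memv_imgP[a _ ->]; apply: dilation_mem.
  rewrite limg_dim_eq //; apply/eqP; rewrite -subv0; apply/subvP=> a.
  rewrite memv_cap memv_ker memv0 => /andP[Aa /eqP da0].
  by apply/eqP/ker0 => //; rewrite da0 mulr0.
move=> b c Ab Ac /eqP; rewrite -subr_eq0 -mulrBr => /eqP ubc.
have: b - c \in sg_comp A i by rewrite rpredB.
rewrite -{1}dil_onto => /memv_imgP[a Aa bcE]; rewrite bcE in ubc.
by apply/eqP; rewrite -subr_eq0 bcE (ker0 a Aa ubc) linear0.
Qed.

Lemma multiplier_surj i :
  @mul_surj K (Gr z) gr_multiplier i (d + i) ->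
  generic (fun s => mul_surj (multiplier s) i (d + i)).
Proof.
move=> H_surj.
have rees_sub e : (rees i e @: sg_comp A i <= gr_comp z (d + i))%VS.
  by apply/subvP=> _ /memv_imgP[a _ ->]; apply: rees_mem.
have rees_surj : (gr_comp z (d + i) <= rees i 0 @: sg_comp A i)%VS.
  apply/subvP=> y /H_surj[x /(subvP (symbol_surj i))/memv_imgP[a Aa ->] <-].
  by rewrite -rees0 memv_img.
have := generic_and (generic_neq0 K) (generic_surj (zorder_gt0 z) rees_sub rees_surj).
apply: generic_mono => s [s_neq0 s_surj] b Ab.
have sdp_neq0 : s ^+ (d + p) != 0 by rewrite expf_neq0.
have /memv_imgP[a Aa bE] := subvP s_surj _ (symbol_mem (d + i) s b).
have Am : multiplier s \in sg_comp A d.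
  rewrite rpred_sum // => r _; rewrite rpredZ //.
  by have /zcompP[] := Fm r.
exists (s ^- (d + p) *: dilation i s a); first by rewrite rpredZ ?dilation_mem.
apply/eqP; rewrite -subr_eq0; apply/eqP; apply: (@symbol_inj (d + i) s _ s_neq0).
  by rewrite rpredB ?sg_mul ?rpredZ ?dilation_mem.
rewrite -scalerAr linearB linearZ /= -rees_pencil scalerA mulVf // scale1r bE.
exact: subrr.
Qed.
End Multiplier.
End Symbols.

(** * Linear forms and their powers *)

Section LinearForms.
Variables (K : fieldType) (A : sgAlg K) (z : linform A).
Local Notation G := (gr_type z).

Lemma zcomp_exp i k a r :
  a \in zcomp z i k -> a ^+ r \in zcomp z (i * r) (k * r).
Proof.
move=> Fa; elim: r => [|r IHr]; first by rewrite !muln0 expr0 zcomp0 sg_one.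
by rewrite exprS !mulnS zcomp_mul.
Qed.

Lemma gr_cls_exp k a r : a \in zideal z k ->
  gr_cls z k a ^+ r = gr_cls z (k * r) (a ^+ r).
Proof.
move=> Ia; have Ir n : a ^+ n \in zideal z (k * n).
  elim: n => [|n IHn]; first by rewrite muln0 zideal0.
  by rewrite exprS mulnS zideal_mul.
elim: r => [|r IHr]; first by rewrite muln0.
by rewrite exprS IHr [LHS]gr_mul_cls // -exprS mulnS.
Qed.

(** In degree 1 only the first two summands of [Gr z] are nonzero, as the
    elements of (z^k) have no component in degrees below [k]. *)
Lemma gr_linear_form x : x \in gr_comp z 1 -> exists g w,
  [/\ g \in sg_comp A 1, w \in zcomp z 1 1 & x = gr_cls z 0 g + gr_cls z 1 w].
Proof.
move: x; apply: gr_comp_ind.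
- by exists 0, 0; rewrite !mem0v !linear0 addr0.
- move=> x y [g [w [Ag Fw ->]]] [g' [w' [Ag' Fw' ->]]].
  by exists (g + g'), (w + w'); rewrite !rpredD // !linearD addrACA.
case=> [|[|k]] a Ia Aa.
- by exists a, 0; rewrite mem0v linear0 addr0.
- exists 0, a; rewrite mem0v linear0 add0r; split=> //; exact/zcompP.
by exists 0, 0; have [c _ ->] := zideal_comp Ia Aa; rewrite !mem0v !linear0 addr0.
Qed.

Section Powers.
Variables (g w : A) (d : nat).
Hypotheses (Ag : g \in sg_comp A 1) (Fw : w \in zcomp z 1 1).

(** The terms of the binomial expansion of [(g + w) ^+ d], sorted by the power of
    [w], that is, by filtration index. *)
Definition power_terms r : A := (g ^+ (d - r) * w ^+ r) *+ 'C(d, r).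

Lemma power_terms_mem r : power_terms r \in zcomp z d r.
Proof.
have [lt_dr|le_rd] := ltnP d r; first by rewrite /power_terms bin_small ?mem0v.
have Fg : g \in zcomp z 1 0 by rewrite zcomp0.
rewrite rpredMn //; have := zcomp_mul (zcomp_exp (d - r) Fg) (zcomp_exp r Fw).
by rewrite !mul1n mul0n subnK.
Qed.

Lemma power_gr_multiplier :
  gr_multiplier z d power_terms = (gr_cls z 0 g + gr_cls z 1 w) ^+ d.
Proof.
rewrite exprDn_comm; last exact: gr_mulC.
apply: eq_bigr => r _; have /zcompP[Iw _] := Fw.
rewrite !gr_cls_exp ?zideal0 // mul0n mul1n [_ * _]gr_mul_cls ?zideal0 //.
  by rewrite add0n linearMn.
by have /zcompP[] := zcomp_exp r Fw; rewrite mul1n.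
Qed.

Lemma power_multiplier s : multiplier d power_terms s = (s *: g + w) ^+ d.
Proof.
rewrite exprDn_comm; last exact: sg_mulC.
by apply: eq_bigr => r _; rewrite exprZn -scalerAl scalerMnr.
Qed.
End Powers.

Variables (g w : A).
Hypotheses (Ag : g \in sg_comp A 1) (Fw : w \in zcomp z 1 1).
Let h : G := gr_cls z 0 g + gr_cls z 1 w.

Lemma power_inj d i : @mul_inj K (Gr z) (h ^+ d) i ->
  generic (fun s => mul_inj ((s *: g + w) ^+ d) i).
Proof.
rewrite -power_gr_multiplier // => /multiplier_inj inj_s.
apply: generic_mono (inj_s _) => [s|r]; first by rewrite power_multiplier.
exact: power_terms_mem.
Qed.

Lemma power_surj d i : @mul_surj K (Gr z) (h ^+ d) i (d + i) ->
  generic (fun s => mul_surj ((s *: g + w) ^+ d) i (d + i)).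
Proof.
rewrite -power_gr_multiplier // => /multiplier_surj surj_s.
apply: generic_mono (surj_s _) => [s|r]; first by rewrite power_multiplier.
exact: power_terms_mem.
Qed.
End LinearForms.

(** * Lifting the Lefschetz properties from the associated graded algebra *)

Section Lift.
Variables (K : fieldType) (charK : [pchar K] =i pred0) (A : sgAlg K) (z : linform A).

Lemma linform_pencil (g w : A) s : g \in sg_comp A 1 -> w \in zcomp z 1 1 ->
  exists l : linform A, vsval l = s *: g + w.
Proof.
move=> Ag /zcompP[_ Aw]; exists (vsproj (sg_comp A 1) (s *: g + w)).
by rewrite vsprojK // rpredD ?rpredZ.
Qed.

Lemma WLP_lift : WLP (Gr z) -> WLP A.
Proof.
case=> h hP; have [g [w [Ag Fw hE]]] := gr_linear_form (subvsP h).
have /(generic_witness charK)[s sP] : generic (fun s =>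
    forall i, (i < sg_top A)%N -> mul_inj (s *: g + w) i \/ mul_surj (s *: g + w) i i.+1).
  apply: generic_forall => i lt_i; case: (hP i lt_i); rewrite hE.
    by move/(@power_inj _ _ _ _ _ Ag Fw 1); apply: generic_mono; left.
  by move/(@power_surj _ _ _ _ _ Ag Fw 1); apply: generic_mono; right.
by have [l lE] := linform_pencil s Ag Fw; exists l; rewrite lE.
Qed.

Lemma SLP_lift : SLP (Gr z) -> SLP A.
Proof.
case=> h hP; have [g [w [Ag Fw hE]]] := gr_linear_form (subvsP h).
have /(generic_witness charK)[s sP] : generic (fun s =>
    forall i, (i < (sg_top A)./2.+1)%N ->
    let u := (s *: g + w) ^+ (sg_top A - i.*2) in
    mul_inj u i /\ mul_surj u i (sg_top A - i)).
  apply: generic_forall => i; rewrite ltnS => le_i.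
  have [] := hP i le_i; rewrite hE.
  have le_i2 : (i.*2 <= sg_top A)%N by rewrite -geq_half_double.
  have -> : (sg_top (Gr z) - i = sg_top A - i.*2 + i)%N.
    by rewrite -[sg_top (Gr z)](subnK le_i2) -addnn addnA addnK.
  move=> /(power_inj Ag Fw) inj_i /(power_surj Ag Fw) surj_i.
  exact: generic_and inj_i surj_i.
have [l lE] := linform_pencil s Ag Fw; exists l => i; rewrite lE -ltnS.
exact: sP.
Qed.
End Lift.

(** * The associated graded algebra of the zero form *)

Section ZeroForm.
Variables (K : fieldType) (A : sgAlg K).
Local Notation z0 := (0 : linform A).

Lemma zorder0 : zorder z0 = 1%N.
Proof.
apply/eqP; rewrite eqn_leq zorder_gt0 andbT /zorder.
by case: ex_minnP => n _; apply; rewrite expr1.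
Qed.

Lemma gr0_cls_inj : injective (gr_cls z0 0).
Proof.
move=> a b; rewrite gr_cls_eq ?zorder_gt0 ?zideal0 // => /zidealP[c /eqP].
by rewrite expr1 mul0r subr_eq0 => /eqP.
Qed.

Lemma gr0_compP i x :
  x \in gr_comp z0 i <-> exists2 a, a \in sg_comp A i & x = gr_cls z0 0 a.
Proof.
split=> [|[a Aa ->]]; last by rewrite gr_cls_comp ?zideal0.
move: x; apply: gr_comp_ind; first by exists 0; rewrite ?mem0v ?linear0.
  move=> x y [a Aa ->] [b Ab ->]; exists (a + b); rewrite ?linearD //.
  exact: rpredD.
case=> [|k] a _ Aa; first by exists a.
by exists 0; rewrite ?mem0v // gr_cls_out ?zorder0 // linear0.
Qed.

Lemma gr0_clsM a b : gr_cls z0 0 a * gr_cls z0 0 b = gr_cls z0 0 (a * b).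
Proof. by rewrite [LHS]gr_mul_cls ?zideal0. Qed.

Lemma mul_inj_gr0 u i : mul_inj u i -> @mul_inj K (Gr z0) (gr_cls z0 0 u) i.
Proof.
move=> u_inj _ _ /gr0_compP[a Aa ->] /gr0_compP[b Ab ->].
by rewrite !gr0_clsM => /gr0_cls_inj/u_inj->.
Qed.

Lemma mul_surj_gr0 u i j :
  mul_surj u i j -> @mul_surj K (Gr z0) (gr_cls z0 0 u) i j.
Proof.
move=> u_surj _ /gr0_compP[b Ab ->]; have [a Aa <-] := u_surj b Ab.
exists (gr_cls z0 0 a); last exact: gr0_clsM.
by apply/gr0_compP; exists a.
Qed.

Lemma linform_gr0 (g : linform A) :
  exists h : linform (Gr z0), vsval h = gr_cls z0 0 (vsval g).
Proof.
exists (vsproj (sg_comp (Gr z0) 1) (gr_cls z0 0 (vsval g))).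
by rewrite vsprojK // gr_cls_comp ?zideal0 ?subvsP.
Qed.

Lemma WLP_gr0 : WLP A -> WLP (Gr z0).
Proof.
case=> g gP; have [h hE] := linform_gr0 g; exists h => i /gP; rewrite hE.
by case=> [/mul_inj_gr0|/mul_surj_gr0]; [left | right].
Qed.

Lemma SLP_gr0 : SLP A -> SLP (Gr z0).
Proof.
case=> g gP; have [h hE] := linform_gr0 g; exists h => i /gP; rewrite hE.
case=> /mul_inj_gr0 inj_i /mul_surj_gr0 surj_i.
by rewrite gr_cls_exp ?zideal0 // mul0n.
Qed.
End ZeroForm.

Theorem theorem1p1 (K : fieldType) (charK : [pchar K]%R =i pred0) (A : sgAlg K) :
  (WLP A <-> exists z : linform A, WLP (Gr z)) /\
  (SLP A <-> exists z : linform A, SLP (Gr z)).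
Proof.
split; split=> [LA|[z]].
- by exists 0; apply: WLP_gr0.
- exact: WLP_lift.
- by exists 0; apply: SLP_gr0.
exact: SLP_lift.
Qed.
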